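(* Let $G$ be a finite group, let $g\in G$, and let $a,b,c$ be integers with $g^{a+b+c}=1$. Then the triple $(g^a,g^b,g^c)$ is an admissible starting triple in the group ring $\mathbb R[G]$ with anti-involution $\sigma(\sum_h a_hh)=\sum_h a_hh^{-1}$ (with $R=\mathbb Z[G]$ and $P$ the positive cone of $\mathbb R[G]$ described in the context).
   Context: Write $G=\{g_1,\dots,g_n\}$ and embed $\mathbb R[G]$ in $\mathrm{Mat}_n(\mathbb R)$ by sending $\sum_h a_hh$ to the matrix whose $(i,j)$ entry is $a_{g_i^{-1}g_j}$; this is a ring homomorphism intertwining $\sigma$ with matrix transpose. The positive structure $P$ on $\mathbb R[G]$ is the set of elements whose image is a symmetric positive definite matrix. For a triple $(x,y,z)$ of invertible elements, the noncommutative angles are the six elements $\sigma(x^{-1})y\sigma(z^{-1})$, $\sigma(y^{-1})z\sigma(x^{-1})$, $\sigma(z^{-1})x\sigma(y^{-1})$, $\sigma(z^{-1})y\sigma(x^{-1})$, $\sigma(x^{-1})z\sigma(y^{-1})$, $\sigma(y^{-1})x\sigma(z^{-1})$. An admissible starting triple for $(R,P)$ is a triple $(x,y,z)$ such that $x,y,z$ are units in $R$ and all six noncommutative angles lie in $P$. *)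

(* Defs.v *)
From HB Require Import structures.
From mathcomp Require Import all_boot all_order all_algebra all_fingroup.
From mathcomp Require Import boolp reals.

Set Implicit Arguments.
Unset Strict Implicit.
Unset Printing Implicit Defensive.

Import Order.TTheory GRing.Theory Num.Theory.
Local Open Scope ring_scope.

(* MathComp has no integer powers in a finGroupType; Negz n is - n.+1. *)
Definition expgz (gT : finGroupType) (g : gT) (k : int) : gT :=
  match k with
  | Posz n => (g ^+ n)%g
  | Negz n => (g ^- n.+1)%g
  end.

(* The formal sum \sum_h a_h h is represented by its coefficient function. The
   constant group_ring hides the pointwise product that {ffun gT -> K} carries
   in MathComp; multiplication here is convolution. *)
Definition group_ring (K : nzRingType) (gT : finGroupType) : Type :=
  {ffun gT -> K}.

HB.instance Definition _ (K : nzRingType) (gT : finGroupType) :=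
  GRing.Lmodule.copy (group_ring K gT) {ffun gT -> K^o}.

Section GroupRing.
Variables (K : nzRingType) (gT : finGroupType).
Local Notation KG := (group_ring K gT).
Implicit Types (u v w : KG) (g h k : gT).

Definition coef u : gT -> K := fun_of_fin u.

Definition gelt g : KG := [ffun h => (h == g)%:R].

Lemma coefP u v : (forall h, coef u h = coef v h) -> u = v.
Proof. by move=> e; apply/ffunP. Qed.

Lemma coefD u v h : coef (u + v) h = coef u h + coef v h.
Proof. exact: ffunE. Qed.

Lemma coefN u h : coef (- u) h = - coef u h.
Proof. exact: ffunE. Qed.

Lemma coef0 h : coef (0 : KG) h = 0.
Proof. exact: ffunE. Qed.

Lemma coefZ (c : K) u h : coef (c *: u) h = c * coef u h.
Proof. exact: ffunE. Qed.

Lemma coef_sum (I : finType) (F : I -> KG) h :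
  coef (\sum_i F i) h = \sum_i coef (F i) h.
Proof.
by apply: (big_morph (fun u => coef u h)) => [u v|]; rewrite ?coefD ?coef0.
Qed.

Lemma coef_gelt g h : coef (gelt g) h = (h == g)%:R.
Proof. exact: ffunE. Qed.

Lemma group_ring_sum u : u = \sum_h coef u h *: gelt h.
Proof.
apply: coefP => h; rewrite coef_sum (bigD1 h) //= coefZ coef_gelt eqxx mulr1.
rewrite big1 ?addr0 // => k nkh.
by rewrite coefZ coef_gelt eq_sym (negPf nkh) mulr0.
Qed.

Definition gmul u v : KG := [ffun h => \sum_k coef u k * coef v (k^-1 * h)%g].

Lemma coef_gmul u v h :
  coef (gmul u v) h = \sum_k coef u k * coef v (k^-1 * h)%g.
Proof. exact: ffunE. Qed.

Lemma gmulA : associative gmul.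
Proof.
move=> u v w; apply: coefP => h; rewrite !coef_gmul.
under eq_bigr do rewrite coef_gmul mulr_sumr.
under [RHS]eq_bigr do rewrite coef_gmul mulr_suml.
rewrite [RHS]exchange_big /=; apply: eq_bigr => k _.
rewrite [RHS](reindex_inj (mulgI k)) /=; apply: eq_bigr => l _.
by rewrite mulrA mulKg invMg mulgA.
Qed.

Lemma coef_geltM g v h : coef (gmul (gelt g) v) h = coef v (g^-1 * h)%g.
Proof.
rewrite coef_gmul (bigD1 g) //= coef_gelt eqxx mul1r big1 ?addr0 // => k nkg.
by rewrite coef_gelt (negPf nkg) mul0r.
Qed.

Lemma gmul1l : left_id (gelt 1%g) gmul.
Proof. by move=> v; apply: coefP => h; rewrite coef_geltM invg1 mul1g. Qed.

Lemma gmul1r : right_id (gelt 1%g) gmul.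
Proof.
move=> v; apply: coefP => h; rewrite coef_gmul (bigD1 h) //= coef_gelt mulVg.
rewrite eqxx mulr1 big1 ?addr0 // => k nkh.
by rewrite coef_gelt -eq_mulVg1 (negPf nkh) mulr0.
Qed.

Lemma gmulDl : left_distributive gmul +%R.
Proof.
move=> u v w; apply: coefP => h; rewrite coefD !coef_gmul -big_split /=.
by apply: eq_bigr => k _; rewrite coefD mulrDl.
Qed.

Lemma gmulDr : right_distributive gmul +%R.
Proof.
move=> u v w; apply: coefP => h; rewrite coefD !coef_gmul -big_split /=.
by apply: eq_bigr => k _; rewrite coefD mulrDr.
Qed.

Lemma gelt1_neq0 : gelt 1%g != 0.
Proof.
apply/eqP => /(congr1 (fun u => coef u 1%g)).
by rewrite coef_gelt coef0 eqxx => /eqP; rewrite oner_eq0.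
Qed.

HB.instance Definition _ := GRing.Zmodule_isNzRing.Build KG
  gmulA gmul1l gmul1r gmulDl gmulDr gelt1_neq0.

Lemma coefM u v h : coef (u * v) h = \sum_k coef u k * coef v (k^-1 * h)%g.
Proof. exact: coef_gmul. Qed.

Lemma gelt1 : gelt 1%g = 1.
Proof. by []. Qed.

Lemma geltM g h : gelt (g * h)%g = gelt g * gelt h.
Proof.
apply: coefP => k; rewrite [RHS]coef_geltM !coef_gelt.
by rewrite -(inj_eq (mulgI g^-1%g)) mulKg.
Qed.

(* Units are the two-sided invertible elements; the inverse is chosen
   classically. *)
Definition gr_unit : pred KG := fun u => `[< exists v, v * u = 1 /\ u * v = 1 >].

Definition gr_inv u : KG :=
  if pselect (exists v, v * u = 1 /\ u * v = 1) is left e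
  then projT1 (cid e) else u.

Lemma gr_mulVr : {in gr_unit, left_inverse 1 gr_inv *%R}.
Proof.
move=> u /asboolP e; rewrite /gr_inv; case: pselect => // e'.
by case: cid => v [].
Qed.

Lemma gr_divrr : {in gr_unit, right_inverse 1 gr_inv *%R}.
Proof.
move=> u /asboolP e; rewrite /gr_inv; case: pselect => // e'.
by case: cid => v [].
Qed.

Lemma gr_unitP u v : v * u = 1 /\ u * v = 1 -> gr_unit u.
Proof. by move=> e; apply/asboolP; exists v. Qed.

Lemma gr_inv_out : {in [predC gr_unit], gr_inv =1 id}.
Proof.
by move=> u /asboolPn ne; rewrite /gr_inv; case: pselect.
Qed.

HB.instance Definition _ := GRing.NzRing_hasMulInverse.Build KG
  gr_mulVr gr_divrr gr_unitP gr_inv_out.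

Definition gr_sigma u : KG := \sum_h coef u h *: gelt h^-1%g.

Lemma coef_sigma u h : coef (gr_sigma u) h = coef u h^-1%g.
Proof.
rewrite /gr_sigma coef_sum (bigD1 h^-1%g) //= coefZ coef_gelt invgK eqxx mulr1.
rewrite big1 ?addr0 // => k nkh; rewrite coefZ coef_gelt.
by rewrite -(inj_eq invg_inj) invgK eq_sym (negPf nkh) mulr0.
Qed.

Lemma gr_sigmaK : involutive gr_sigma.
Proof. by move=> u; apply: coefP => h; rewrite !coef_sigma invgK. Qed.

Lemma gr_sigmaD u v : gr_sigma (u + v) = gr_sigma u + gr_sigma v.
Proof. by apply: coefP => h; rewrite coefD !coef_sigma coefD. Qed.

(* The enumeration g_1, ..., g_n of the group is enum_val. *)
Definition gr_mx u : 'M[K]_#|gT| :=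
  \matrix_(i, j) coef u ((enum_val i)^-1 * enum_val j)%g.

Lemma gr_mx1 : gr_mx 1 = 1%:M.
Proof.
apply/matrixP => i j; rewrite !mxE coef_gelt -eq_mulVg1.
by rewrite (inj_eq enum_val_inj).
Qed.

Lemma gr_mxD u v : gr_mx (u + v) = gr_mx u + gr_mx v.
Proof. by apply/matrixP => i j; rewrite !mxE coefD. Qed.

Lemma gr_mxM u v : gr_mx (u * v) = gr_mx u *m gr_mx v.
Proof.
apply/matrixP => i j; rewrite !mxE coefM.
rewrite (reindex_inj (mulgI (enum_val i)^-1%g)) /=.
rewrite (reindex (@enum_val _ (mem gT))) /=; last first.
  by exists enum_rank => x _; rewrite ?enum_valK ?enum_rankK.
apply: eq_bigr => k _; rewrite !mxE; congr (_ * coef v _).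
by rewrite invMg invgK -mulgA mulKVg.
Qed.

Lemma gr_mx_sigma u : gr_mx (gr_sigma u) = (gr_mx u)^T.
Proof. by apply/matrixP => i j; rewrite !mxE coef_sigma invMg invgK. Qed.

End GroupRing.

Lemma gr_sigmaM (K : comNzRingType) (gT : finGroupType) (u v : group_ring K gT) :
  gr_sigma (u * v) = gr_sigma v * gr_sigma u.
Proof.
apply: coefP => h; rewrite coef_sigma !coefM.
rewrite (reindex_inj (mulgI h^-1%g)) /=; apply: eq_bigr => k _.
by rewrite mulrC !coef_sigma !invMg !invgK mulgK.
Qed.

Section IntegralGroupRing.
Variables (R : realType) (gT : finGroupType).

(* Z[G] as a subring of R[G]. *)
Definition int_group_ring : {pred group_ring R gT} :=
  [pred u | [forall h, coef u h \is a Num.int]].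

Lemma int_group_ringP (u : group_ring R gT) :
  reflect (forall h, coef u h \is a Num.int) (u \in int_group_ring).
Proof. exact: forallP. Qed.

Lemma int_group_ring_subring : subring_closed int_group_ring.
Proof.
split=> [|u v /int_group_ringP hu /int_group_ringP hv
          |u v /int_group_ringP hu /int_group_ringP hv];
  apply/int_group_ringP => h.
- by rewrite coef_gelt rpred_nat.
- by rewrite coefD coefN rpredB.
- by rewrite coefM rpred_sum // => k _; rewrite rpredM.
Qed.

HB.instance Definition _ :=
  GRing.isSubringClosed.Build (group_ring R gT) int_group_ring
    int_group_ring_subring.

End IntegralGroupRing.

Definition posdefmx (R : realType) (n : nat) (M : 'M[R]_n) : Prop :=
  forall v : 'cV[R]_n, v != 0 -> 0 < (v^T *m M *m v) 0 0.

Definition gr_pos (R : realType) (gT : finGroupType) (u : group_ring R gT) : Prop :=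
  (gr_mx u)^T = gr_mx u /\ posdefmx (gr_mx u).

Section Admissible.
Variables (A : unitRingType) (sigma : A -> A).

Definition unit_in (S : {pred A}) (x : A) : Prop :=
  x \in S /\ exists2 y, y \in S & x * y = 1 /\ y * x = 1.

Definition angles (x y z : A) : seq A :=
  [:: sigma (x^-1) * y * sigma (z^-1);
      sigma (y^-1) * z * sigma (x^-1);
      sigma (z^-1) * x * sigma (y^-1);
      sigma (z^-1) * y * sigma (x^-1);
      sigma (x^-1) * z * sigma (y^-1);
      sigma (y^-1) * x * sigma (z^-1)].

Definition admissible_triple (S : subringClosed A) (P : A -> Prop) (x y z : A)
    : Prop :=
  [/\ unit_in S x, unit_in S y, unit_in S z
    & forall t, t \in angles x y z -> P t].

End Admissible.

(* Main.v *)
Require Import Defs.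
From mathcomp Require Import all_boot all_order all_algebra all_fingroup.
From mathcomp Require Import reals.
Import Order.TTheory GRing.Theory Num.Theory.
Local Open Scope ring_scope.

(** For a group element [h], both inversion and [gr_sigma] send [gelt h] to
    [gelt h^-1], so [gr_sigma (gelt h)^-1 = gelt h]. Hence every noncommutative
    angle of a triple of group elements is the product, in some order, of the
    three elements ([angle_gelt]). If two of them commute and the triple has
    product 1, the order does not matter and all six angles equal 1, whose matrix
    is the identity ([commute_admissible]). Integer powers of [g] commute, and
    their product is [g] to the sum of the exponents ([expgzD]). *)

Section IntegerPowers.
Variables (gT : finGroupType) (g : gT).
Local Open Scope group_scope.

(** Writing an integer as a difference of naturals removes the case analysis
    on signs from the additivity of exponents. *)
Lemma expgz_subn (m n : nat) : expgz g (m%:Z - n%:Z)%R = g ^+ m * g ^- n.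
Proof.
case: (leqP n m) => [le_nm | lt_mn].
  by rewrite subzn //= expgnFr.
have le_mn := ltnW lt_mn.
rewrite -opprB subzn // -[in RHS](subnK le_mn) expgnDr invMg mulKVg.
by case: (n - m)%N (lt_mn) => [|k] //=; rewrite ?invg1.
Qed.

Lemma int_subnE (k : int) : exists m n : nat, k = (m%:Z - n%:Z)%R.
Proof.
case: k => n; first by exists n, 0%N; rewrite subr0.
by exists 0%N, n.+1; rewrite sub0r NegzE.
Qed.

Lemma commute_expgz (a b : int) : commute (expgz g a) (expgz g b).
Proof.
have cg k : commute g (expgz g k).
  by case: k => n /=; [exact: commuteX | exact/commuteV/commuteX].
have cXg n : commute (expgz g b) (g ^+ n) by exact/commuteX/commute_sym/cg.
by case: a => n /=; apply/commute_sym; [|apply: commuteV]; apply: cXg.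
Qed.

Lemma expgzD (a b : int) : expgz g (a + b)%R = expgz g a * expgz g b.
Proof.
have [m [n ->]] := int_subnE a; have [p [q ->]] := int_subnE b.
rewrite addrACA -opprD -!PoszD !expgz_subn !expgnDr invMg.
have cpn : commute (g ^+ p) (g ^- n).
  exact/commuteV/commuteX/commute_sym/commuteX.
have cqn : commute (g ^- q) (g ^- n).
  exact/commuteV/commute_sym/commuteV/commuteX/commute_sym/commuteX.
by rewrite cqn !mulgA -(mulgA (g ^+ m)) cpn !mulgA.
Qed.

End IntegerPowers.

Section GroupElements.
Variables (R : realType) (gT : finGroupType).
Implicit Types h k l : gT.
Local Notation gelt := (gelt R).

Lemma gelt_unit h : gelt h \is a GRing.unit.
Proof.
by apply/unitrP; exists (gelt h^-1%g); rewrite -!geltM mulVg mulgV.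
Qed.

Lemma gelt_inv h : (gelt h)^-1 = gelt h^-1%g.
Proof.
by apply: (mulrI (gelt_unit h)); rewrite divrr ?gelt_unit // -geltM mulgV.
Qed.

Lemma gr_sigma_gelt h : gr_sigma (gelt h) = gelt h^-1%g.
Proof.
by apply: coefP => k; rewrite coef_sigma !coef_gelt -(inj_eq invg_inj) invgK.
Qed.

Lemma gelt_unit_in h : unit_in (@int_group_ring R gT) (gelt h).
Proof.
have gelt_int k : gelt k \in @int_group_ring R gT.
  by apply/int_group_ringP => l; rewrite coef_gelt rpred_nat.
by split=> //; exists (gelt h^-1%g); rewrite // -!geltM mulVg mulgV.
Qed.

Lemma angle_gelt h k l :
  gr_sigma (gelt h)^-1 * gelt k * gr_sigma (gelt l)^-1 = gelt (h * k * l)%g.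
Proof. by rewrite !gelt_inv !gr_sigma_gelt !invgK !geltM. Qed.

(** The matrix of 1 is the identity, whose quadratic form is a sum of squares. *)
Lemma gr_pos1 : gr_pos (1 : group_ring R gT).
Proof.
rewrite /gr_pos gr_mx1; split=> [|v nz_v]; first exact: trmx1.
have sq_ge0 i : true -> 0 <= v^T 0 i * v i 0 by rewrite mxE -expr2 sqr_ge0.
rewrite mulmx1 mxE lt_neqAle sumr_ge0 // andbT eq_sym.
apply: contra nz_v => /eqP/(psumr_eq0P sq_ge0) v0.
apply/eqP/colP => i; apply/eqP; have /eqP := v0 i isT.
by rewrite !mxE mulf_eq0 orbb.
Qed.

(** Three of the angles are cyclic rotations of [h * k * l], which is 1 by
    hypothesis; commutation of [h] and [k] reduces the other three, the
    rotations of [k * h * l], to the same product. *)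
Lemma commute_admissible h k l : commute h k -> (h * k * l = 1)%g ->
  admissible_triple (@gr_sigma R gT) (@int_group_ring R gT) (@gr_pos R gT)
    (gelt h) (gelt k) (gelt l).
Proof.
move=> chk hkl1; split; try exact: gelt_unit_in.
have rot (x y z : gT) : (x * y * z = 1 -> y * z * x = 1)%g.
  by move=> e; apply: (mulgI x); rewrite !mulgA e mul1g mulg1.
have khl1 : (k * h * l = 1)%g by rewrite -chk.
move=> t; rewrite /angles !angle_gelt hkl1 khl1 (rot _ _ _ hkl1).
rewrite (rot _ _ _ (rot _ _ _ hkl1)) (rot _ _ _ khl1).
rewrite (rot _ _ _ (rot _ _ _ khl1)) gelt1 !inE !orbb => /eqP ->.
exact: gr_pos1.
Qed.

End GroupElements.

Theorem proposition8p40 (R : realType) (gT : finGroupType) (g : gT)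
    (a b c : int) (habc : expgz g (a + b + c) = 1%g) :
  admissible_triple (@gr_sigma R gT) (@int_group_ring R gT) (@gr_pos R gT)
    (gelt R (expgz g a)) (gelt R (expgz g b)) (gelt R (expgz g c)).
Proof.
apply: commute_admissible; first exact: commute_expgz.
by rewrite -!expgzD.
Qed.
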